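(* Let $\ell(x,q)$ be a loss function, differentiable in $x\in\mathbb{R}^d$, such that $\|\nabla\ell(x,q)\|\le G$ for all $x$ and $q$, and such that for every $q$ the function $x\mapsto\ell(x,q)$ is $L$-smooth. Let $\mathcal S=(q_1,\dots,q_n)$ and $\mathcal S'=(q_1',\dots,q_n')$ be two data sets that differ at one example. Let $\alpha>0$, $\beta\in[0,1)$, $s\ge0$, and let $x_t$ and $x_t'$ denote the $t$-th iterates of the stochastic unified momentum (SUM) method, with parameters $(\alpha,\beta,s)$ and the same initial point, run for empirical risk minimization on $\mathcal S$ and on $\mathcal S'$ respectively, with the same random indices. Put $\Delta_t=\mathbb{E}[\|x_t-x_t'\|]$. Then $\Delta_0=0$ and for every $t\ge 0$ $$\Delta_{t+1}\le\sum_{k=0}^{t}\frac{2\alpha G}{n}\,\eta_k^t+\left(1-\frac1n\right)\sum_{k=0}^{t}\alpha L\,\eta_k^t\,\Delta_k,\qquad\text{where}\quad \eta_k^t=\frac{1}{1-\beta}-\beta^{t-k+1}\,\frac{1-s(1-\beta)}{1-\beta}.$$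
   Context: $\|\cdot\|$ is the Euclidean norm and $\nabla\ell(x,q)$ is the gradient with respect to $x$. A differentiable function $h$ is $L$-smooth if $\|\nabla h(y)-\nabla h(x)\|\le L\|y-x\|$ for all $x,y\in\mathbb{R}^d$. Empirical risk minimization on $\mathcal S=(q_1,\dots,q_n)$ means minimizing $f(x)=\frac1n\sum_{i=1}^n\ell(x,q_i)$ over $\mathbb{R}^d$. The SUM method for this problem uses at step $k$ the stochastic gradient $g_k=\nabla\ell(x_k,q_{i_k})$, where $i_0,i_1,\dots$ are independent and uniformly distributed on $\{1,\dots,n\}$; starting from $x_0$ with $y^s_0=x_0$, for $k\ge0$, $$y_{k+1}=x_k-\alpha g_k,\qquad y^s_{k+1}=x_k-s\alpha g_k,\qquad x_{k+1}=y_{k+1}+\beta\,(y^s_{k+1}-y^s_k).$$ ''$\mathcal S$ and $\mathcal S'$ differ at one example'' means there is one index $j$ with $q_i=q_i'$ for all $i\ne j$. The two runs start at the same deterministic point $x_0=x_0'$ and are coupled by using the same random indices $i_k$: the run on $\mathcal S'$ uses $\nabla\ell(x_k',q'_{i_k})$ at step $k$. The expectation in $\Delta_t$ is over the random indices. *)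

(* Defs.v *)
From HB Require Import structures.
From mathcomp Require Import all_boot all_order all_algebra.
From mathcomp Require Import all_classical all_reals all_analysis.

Set Implicit Arguments.
Unset Strict Implicit.
Unset Printing Implicit Defensive.

Import Order.TTheory GRing.Theory Num.Theory.
Import numFieldNormedType.Exports.

Local Open Scope classical_set_scope.
Local Open Scope ring_scope.

(* The canonical norm on 'rV[R]_d is the sup norm, hence this definition. *)
Definition enorm (R : realType) (d : nat) (v : 'rV[R]_d) : R :=
  Num.sqrt (\sum_(i < d) v 0 i ^+ 2).

(* [differentiable] below refers to the sup norm on 'rV[R]_d; it is equivalent
   to the Euclidean one, so the notion of differentiability is the same. *)
Definition gradient (R : realType) (d : nat) (h : 'rV[R]_d -> R)
    (x : 'rV[R]_d) : 'rV[R]_d :=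
  \row_(i < d) 'D_(delta_mx 0 i) h x.

Definition smooth (R : realType) (d : nat) (L : R) (h : 'rV[R]_d -> R) : Prop :=
  (forall x, differentiable h x) /\
  (forall x y, enorm (gradient h y - gradient h x) <= L * enorm (y - x)).

Definition differ_at_one (Q : Type) (n : nat) (qs qs' : n.-tuple Q) : Prop :=
  exists j : 'I_n, forall i, i != j -> tnth qs i = tnth qs' i.

(* The pair (x_k, y^s_k), for the stochastic gradients g_k = g k x_k. *)
Fixpoint SUM_state (R : realType) (d : nat) (alpha beta s : R)
    (g : nat -> 'rV[R]_d -> 'rV[R]_d) (x0 : 'rV[R]_d) (k : nat) :
    'rV[R]_d * 'rV[R]_d :=
  if k is k'.+1 then
    let: (x, ys) := SUM_state alpha beta s g x0 k' in
    let y_next := x - alpha *: g k' x in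
    let ys_next := x - (s * alpha) *: g k' x in
    (y_next + beta *: (ys_next - ys), ys_next)
  else (x0, x0).

Definition SUM_iterate (R : realType) (d : nat) (alpha beta s : R)
    (g : nat -> 'rV[R]_d -> 'rV[R]_d) (x0 : 'rV[R]_d) (k : nat) : 'rV[R]_d :=
  (SUM_state alpha beta s g x0 k).1.

(* [idx] is a realization i_0, i_1, ... of the sampled indices. *)
Definition SUM_erm (R : realType) (d : nat) (Q : Type)
    (l : 'rV[R]_d -> Q -> R) (n : nat) (qs : n.-tuple Q) (alpha beta s : R)
    (x0 : 'rV[R]_d) (idx : nat -> 'I_n) (k : nat) : 'rV[R]_d :=
  SUM_iterate alpha beta s
    (fun m x => gradient (fun y => l y (tnth qs (idx m))) x) x0 k.

(* Random variables with values in the discrete space 'I_n: every subset of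
   'I_n is measurable, and mutual independence is the product rule over all
   finite families of indices and all events. *)
Definition random_indices (disp : measure_display) (T : measurableType disp)
    (n : nat) (I : nat -> T -> 'I_n) : Prop :=
  forall k (A : set 'I_n), measurable (I k @^-1` A).

Definition uniform_indices (disp : measure_display) (T : measurableType disp)
    (R : realType) (P : probability T R) (n : nat) (I : nat -> T -> 'I_n) :
    Prop :=
  forall k (i : 'I_n), P (I k @^-1` [set i]) = (n%:R^-1)%:E.

Definition independent_indices (disp : measure_display)
    (T : measurableType disp) (R : realType) (P : probability T R) (n : nat)
    (I : nat -> T -> 'I_n) : Prop :=
  forall (J : seq nat) (A : nat -> set 'I_n), uniq J ->
    P (\bigcap_(k in [set` J]) (I k @^-1` A k)) =
    (\prod_(k <- J) P (I k @^-1` A k))%E.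

Definition SUM_eta (R : realType) (beta s : R) (k t : nat) : R :=
  1 / (1 - beta)
  - beta ^+ (t - k + 1) * ((1 - s * (1 - beta)) / (1 - beta)).

Definition Delta (disp : measure_display) (T : measurableType disp)
    (R : realType) (P : probability T R) (d : nat) (Q : Type)
    (l : 'rV[R]_d -> Q -> R) (n : nat) (qs qs' : n.-tuple Q)
    (alpha beta s : R) (x0 : 'rV[R]_d) (I : nat -> T -> 'I_n) (t : nat) :
    \bar R :=
  ('E_P[fun w => enorm (SUM_erm l qs alpha beta s x0 (I^~ w) t
                        - SUM_erm l qs' alpha beta s x0 (I^~ w) t)])%E.

(* Main.v *)
(* Unrolling the recursion gives x_{t+1} = x_0 - alpha * sum_k eta_k^t g_k with
   eta_k^t >= 0, so ||x_{t+1} - x'_{t+1}|| is at most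
   alpha * sum_k eta_k^t ||g_k - g'_k||.  The k-th difference of gradients is at
   most 2 G when i_k is the differing index j, and at most L ||x_k - x'_k||
   otherwise; since i_k is uniform and independent of x_k - x'_k, these cases
   contribute 2 G / n and (1 - 1/n) L Delta_k in expectation.  All expectations
   up to time t+1 are averages over the n^(t+1) values of (i_0, ..., i_t), so the
   independence argument becomes an exchange of values at one coordinate. *)

Require Import Defs.
From HB Require Import structures.
From mathcomp Require Import all_boot all_order all_algebra.
From mathcomp Require Import all_classical all_reals all_analysis.
From mathcomp Require Import perm measurable_realfun ring lra.

Import Order.TTheory GRing.Theory Num.Theory.
Import numFieldNormedType.Exports.

Local Open Scope classical_set_scope.
Local Open Scope ring_scope.

(** * The Euclidean norm *)

Lemma sum_cauchy_schwarz {R : realDomainType} {I : finType} (a b : I -> R) :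
  (\sum_i a i * b i) ^+ 2 <= (\sum_i a i ^+ 2) * (\sum_i b i ^+ 2).
Proof.
set A := \sum_i a i ^+ 2; set B := \sum_i b i ^+ 2; set C := \sum_i a i * b i.
(* Lagrange's identity: twice the gap in the inequality is a double sum of squares. *)
suff lagrange : \sum_i \sum_j (a i * b j - a j * b i) ^+ 2 = (A * B - C ^+ 2) *+ 2.
  rewrite -subr_ge0 -(@pmulrn_lge0 _ _ 2)// -lagrange.
  by apply: sumr_ge0 => i _; apply: sumr_ge0 => j _; exact: sqr_ge0.
have inner i : \sum_j (a i * b j - a j * b i) ^+ 2 =
    a i ^+ 2 * B + b i ^+ 2 * A - a i * b i * C *+ 2.
  rewrite /A /B /C !mulr_sumr -sumrMnl -sumrN -!big_split /=.
  by apply: eq_bigr => j _; ring.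
rewrite (eq_bigr _ (fun i _ => inner i)) !big_split /= sumrN sumrMnl.
by rewrite -!mulr_suml -/A -/B -/C; ring.
Qed.

Section EuclideanNorm.
Context {R : realType} {d : nat}.
Implicit Types u v : 'rV[R]_d.

Lemma enorm_ge0 u : 0 <= enorm u.
Proof. exact: sqrtr_ge0. Qed.

Lemma enorm0 : enorm (0 : 'rV[R]_d) = 0.
Proof.
by rewrite /enorm big1 ?sqrtr0// => i _; rewrite mxE expr0n.
Qed.

Lemma enormZ (c : R) u : enorm (c *: u) = `|c| * enorm u.
Proof.
rewrite /enorm -sqrtr_sqr -sqrtrM ?sqr_ge0// mulr_sumr.
by congr Num.sqrt; apply: eq_bigr => i _; rewrite mxE exprMn.
Qed.

Lemma enormN u : enorm (- u) = enorm u.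
Proof. by rewrite -scaleN1r enormZ normrN1 mul1r. Qed.

Lemma enormD u v : enorm (u + v) <= enorm u + enorm v.
Proof.
have sq_ge0 (w : 'rV[R]_d) : 0 <= \sum_i w 0 i ^+ 2.
  by apply: sumr_ge0 => i _; exact: sqr_ge0.
rewrite -[leRHS]ger0_norm ?addr_ge0 ?enorm_ge0// -[leRHS]sqrtr_sqr.
apply: ler_wsqrtr; rewrite sqrrD !sqr_sqrtr//.
have -> : \sum_i (u + v) 0 i ^+ 2 =
    \sum_i u 0 i ^+ 2 + (\sum_i u 0 i * v 0 i) *+ 2 + \sum_i v 0 i ^+ 2.
  rewrite -sumrMnl -!big_split /=; apply: eq_bigr => i _.
  by rewrite mxE sqrrD.
rewrite lerD2r lerD2l lerMn2r /=.
apply: le_trans (ler_norm _) _.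
rewrite -sqrtr_sqr -sqrtrM//; apply: ler_wsqrtr.
exact: sum_cauchy_schwarz.
Qed.

Lemma enormB u v : enorm (u - v) <= enorm u + enorm v.
Proof. by rewrite -(enormN v); exact: enormD. Qed.

Lemma enorm_sum (I : Type) (r : seq I) (F : I -> 'rV[R]_d) :
  enorm (\sum_(i <- r) F i) <= \sum_(i <- r) enorm (F i).
Proof.
elim/big_ind2 : _ => [|x a y b xa yb|//]; first by rewrite enorm0.
exact: le_trans (enormD _ _) (lerD xa yb).
Qed.

End EuclideanNorm.

(** * The unrolled momentum recursion *)

(* The two invariants of the recursion: with c = 1 - s (1 - beta),
   x - y is a discounted sum of the gradients and
   x + beta / (1 - beta) (x - y) is an undiscounted one. *)
Lemma momentum_recursion {F : fieldType} (alpha beta s x0 : F) (a x y : nat -> F) :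
  beta != 1 -> x 0%N = x0 -> y 0%N = x0 ->
  (forall k, x k.+1 = x k - alpha * a k + beta * (x k - s * alpha * a k - y k)) ->
  (forall k, y k.+1 = x k - s * alpha * a k) ->
  forall t, x t = x0 - alpha * \sum_(k < t)
    (1 / (1 - beta) - beta ^+ (t - k) * ((1 - s * (1 - beta)) / (1 - beta))) * a k.
Proof.
move=> beta1 x0E y0E xS yS t.
have nz : 1 - beta != 0 by rewrite subr_eq0 eq_sym.
set c := 1 - s * (1 - beta).
pose S t := \sum_(k < t) a k.
pose E t := \sum_(k < t) beta ^+ (t - k) * a k.
have SS m : S m.+1 = S m + a m by rewrite /S big_ord_recr.
have ES m : E m.+1 = beta * (E m + a m).
  rewrite /E big_ord_recr /= subSnn expr1 mulrDr mulr_sumr; congr (_ + _).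
  by apply: eq_bigr => i _; rewrite subSn ?(ltnW (ltn_ord i))// exprS mulrA.
(* The factor [beta] on [x t - y t] matches the exponents [t - k >= 1] in [E] and avoids a division
   by [beta], which may be 0. *)
suff [-> _] : x t = x0 - alpha / (1 - beta) * (S t - c * E t) /\
    beta * (x t - y t) = - alpha * c * E t.
  congr (_ - _); rewrite -mulrA; congr (_ * _).
  rewrite /S /E mulr_sumr -sumrB mulr_sumr.
  by apply: eq_bigr => i _; field.
elim: t => [|t [IHx IHd]].
  by rewrite x0E y0E /S /E !big_ord0; split; ring.
have dE : beta * (x t - s * alpha * a t - y t) =
    - alpha * c * E t - beta * (s * alpha * a t) by rewrite -IHd; ring.
rewrite yS xS dE SS ES IHx /c; split; last by ring.
by field.
Qed.

(** The scalar recursion holds in each coordinate. *)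
Lemma SUM_iterateS {R : realType} {d : nat} (alpha beta s : R)
    (g : nat -> 'rV[R]_d -> 'rV[R]_d) (x0 : 'rV[R]_d) (t : nat) : beta != 1 ->
  SUM_iterate alpha beta s g x0 t.+1 =
  x0 - alpha *: \sum_(k < t.+1)
    SUM_eta beta s k t *: g k (SUM_iterate alpha beta s g x0 k).
Proof.
move=> beta1; apply/rowP => i; rewrite !mxE summxE.
pose st := SUM_state alpha beta s g x0.
rewrite (momentum_recursion alpha beta s (x0 0 i)
  (fun k => g k (st k).1 0 i) (fun k => (st k).1 0 i) (fun k => (st k).2 0 i))//.
(* The scalar lemma at [t.+1] has exponent [t.+1 - k]; truncated subtraction gives [(t - k).+1]
   because [k <= t]. *)
- congr (_ - _ * _); apply: eq_bigr => k _; rewrite mxE /SUM_eta addn1.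
  by rewrite subSn// -ltnS.
- by move=> k; rewrite /st /=; case: SUM_state => u v /=; rewrite !mxE.
- by move=> k; rewrite /st /=; case: SUM_state => u v /=; rewrite !mxE.
Qed.

(** With p = beta^(t-k+1) in [0,1], the numerator over 1 - beta is (1 - p) + p s (1 - beta). *)
Lemma SUM_eta_ge0 {R : realType} (beta s : R) (k t : nat) :
  0 <= beta < 1 -> 0 <= s -> 0 <= SUM_eta beta s k t.
Proof.
move=> /andP[b0 b1] s0; rewrite /SUM_eta mulrA -mulrBl.
apply: divr_ge0; last by lra.
have p0 : 0 <= beta ^+ (t - k + 1) by exact: exprn_ge0.
have p1 : beta ^+ (t - k + 1) <= 1 by apply: exprn_ile1 => //; exact: ltW.
have : 0 <= s * (1 - beta) by apply: mulr_ge0 => //; lra.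
nra.
Qed.

(** * Averages over finitely many random indices *)

Lemma SUM_state_ext {R : realType} {d : nat} (alpha beta s : R)
    (g g' : nat -> 'rV[R]_d -> 'rV[R]_d) (x0 : 'rV[R]_d) (t : nat) :
  (forall k, (k < t)%N -> g k = g' k) ->
  SUM_state alpha beta s g x0 t = SUM_state alpha beta s g' x0 t.
Proof.
elim: t => //= t IH gg'; rewrite IH; first by rewrite gg'.
by move=> k /ltnW; exact: gg'.
Qed.

(** Iterate t reads only the indices before t. This reduces expectations to finite averages and
    makes x_k independent of i_k. *)
Lemma SUM_erm_ext {R : realType} {d : nat} {Q : Type}
    (l : 'rV[R]_d -> Q -> R) {n : nat} (qs : n.-tuple Q) (alpha beta s : R)
    (x0 : 'rV[R]_d) (idx idx' : nat -> 'I_n) (t : nat) :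
  (forall k, (k < t)%N -> idx k = idx' k) ->
  SUM_erm l qs alpha beta s x0 idx t = SUM_erm l qs alpha beta s x0 idx' t.
Proof.
move=> ext; rewrite /SUM_erm /SUM_iterate; congr _.1.
by apply: SUM_state_ext => k /ext ->.
Qed.

(* Transposing the values j and c at coordinate k shows that the sum is the
   same for every value j; these n sums add up to the full one. *)
Lemma sum_ffun_coord {R : fieldType} {J : finType} {n : nat} (k : J) (j : 'I_n)
    (F : {ffun J -> 'I_n} -> R) : n%:R != 0 :> R ->
  (forall w w' : {ffun J -> 'I_n}, (forall i, i != k -> w i = w' i) -> F w = F w') ->
  \sum_(w : {ffun J -> 'I_n}) (w k == j)%:R * F w = n%:R^-1 * \sum_w F w.
Proof.
move=> n0 Fext.
have swap c : \sum_(w : {ffun J -> 'I_n}) (w k == c)%:R * F w =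
      \sum_(w : {ffun J -> 'I_n}) (w k == j)%:R * F w.
  pose h (w : {ffun J -> 'I_n}) :=
    [ffun i => if i == k then tperm j c (w i) else w i].
  have hK : involutive h.
    move=> w; apply/ffunP => i; rewrite !ffunE.
    by case: eqP => // _; rewrite tpermK.
  rewrite (reindex_inj (inv_inj hK)); apply: eq_bigr => w _.
  rewrite ffunE eqxx (canF_eq (tpermK j c)) tpermR.
  by congr (_ * _); apply: Fext => i /negbTE ik; rewrite ffunE ik.
apply: (mulfI n0); rewrite mulVKf//.
transitivity (\sum_(c < n) \sum_(w : {ffun J -> 'I_n}) (w k == c)%:R * F w).
  by rewrite (eq_bigr _ (fun c _ => swap c)) sumr_const card_ord mulr_natl.
rewrite exchange_big; apply: eq_bigr => w _.
rewrite -mulr_suml (bigD1 (w k))//= eqxx big1 ?addr0 ?mul1r//.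
by move=> c /negbTE; rewrite eq_sym => ->.
Qed.

(** The events [A w], which prescribe the first N+1 indices, partition the space and have equal
    probability by independence and uniformity. On each of them [f] is constant, so its integral is
    a finite sum. Past N, [inord] returns a default position, which [f] does not read. *)
Lemma expectation_indices {disp : measure_display} {T : measurableType disp}
    {R : realType} (P : probability T R) {n : nat} (I : nat -> T -> 'I_n)
    (N : nat) (f : (nat -> 'I_n) -> R) :
  random_indices I -> uniform_indices P I -> independent_indices P I ->
  (forall idx, 0 <= f idx) ->
  (forall idx idx', (forall k, (k < N.+1)%N -> idx k = idx' k) -> f idx = f idx') ->
  ('E_P[fun x => f (I^~ x)])%E =
  (n%:R^-1 ^+ N.+1 *
   \sum_(w : {ffun 'I_N.+1 -> 'I_n}) f (fun k => w (inord k)))%:E.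
Proof.
move=> mI unifI indepI f0 fext.
pose A (w : {ffun 'I_N.+1 -> 'I_n}) : set T :=
  \bigcap_(k in [set` iota 0 N.+1]) (I k @^-1` [set w (inord k)]).
have AP w x : A w x <-> w = [ffun k : 'I_N.+1 => I k x].
  split=> [Ax|->].
    apply/ffunP => k; rewrite ffunE.
    have kN : val k \in iota 0 N.+1 by rewrite mem_iota leq0n add0n ltn_ord.
    by rewrite [RHS](Ax _ kN) inord_val.
  move=> k kN; have {}kN : (k < N.+1)%N.
    by have := kN : k \in iota 0 N.+1; rewrite mem_iota => /andP[].
  by rewrite ffunE inordK.
have mA w : measurable (A w).
  by apply: bigcap_measurableType => k _; exact: mI.
have PA w : P (A w) = (n%:R^-1 ^+ N.+1)%:E.
  rewrite indepI ?iota_uniq// (eq_bigr (fun=> (n%:R^-1)%:E)); last first.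
    by move=> k _; rewrite unifI.
  by rewrite prodEFin big_const_seq count_predT size_iota -Monoid.iteropE.
rewrite unlock.
transitivity (\int[P]_(x in setT)
    (\sum_(w : {ffun 'I_N.+1 -> 'I_n})
       ((f (fun k => w (inord k)))%:E * (\1_(A w) x)%:E)))%E.
  apply: eq_integral => x _.
  pose v : {ffun 'I_N.+1 -> 'I_n} := [ffun k : 'I_N.+1 => I k x].
  (* Only the event of the indices actually drawn at [x] contributes. *)
  rewrite (bigD1 v)//= big1 ?adde0 => [|w wv].
    rewrite indicE mem_set ?mule1; last exact/AP.
    by congr EFin; apply: fext => k kN; rewrite ffunE inordK.
  rewrite indicE memNset ?mule0// => /AP wE.
  by rewrite wE eqxx in wv.
rewrite ge0_integral_sum//=; last 2 first.
- by move=> w; apply: measurable_funeM; apply/measurable_EFinP; exact: measurable_indic.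
- by move=> w x _; rewrite mule_ge0// lee_fin.
rewrite mulr_sumr -sumEFin; apply: eq_bigr => w _.
rewrite ge0_integralZl_EFin//.
- by rewrite integral_indic// setIT [X in (_ * X)%E]PA -EFinM mulrC.
- by apply/measurable_EFinP; exact: measurable_indic.
Qed.

(** * Distance between the two coupled runs *)

Lemma SUM_iterate_dist_le {R : realType} {d : nat} (alpha beta s : R)
    (g g' : nat -> 'rV[R]_d -> 'rV[R]_d) (x0 : 'rV[R]_d) (t : nat) :
  0 <= alpha -> 0 <= beta < 1 -> 0 <= s ->
  enorm (SUM_iterate alpha beta s g x0 t.+1 - SUM_iterate alpha beta s g' x0 t.+1) <=
  \sum_(k < t.+1) alpha * SUM_eta beta s k t *
    enorm (g k (SUM_iterate alpha beta s g x0 k) -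
           g' k (SUM_iterate alpha beta s g' x0 k)).
Proof.
move=> alpha0 beta01 s0; have beta1 : beta != 1.
  by case/andP: beta01 => _ /lt_eqF ->.
rewrite !SUM_iterateS// opprB addrC addrA subrK -enormN opprB -scalerBr -sumrB.
rewrite enormZ ger0_norm//; under [leRHS]eq_bigr do rewrite -mulrA.
rewrite -mulr_sumr; apply: ler_wpM2l => //.
apply: le_trans (enorm_sum _ _ _) _; apply: ler_sum => k _.
by rewrite -scalerBr enormZ ger0_norm// SUM_eta_ge0.
Qed.

(** The indicator of i_k != j is written as 1 minus that of i_k = j, so that only averages over the
    event i_k = j remain to be computed. *)
Lemma SUM_erm_dist_le {R : realType} {d : nat} {Q : Type}
    (l : 'rV[R]_d -> Q -> R) (G L : R)
    (hG : forall x q, enorm (gradient (fun y => l y q) x) <= G)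
    (hL : forall q, smooth L (fun y => l y q))
    {n : nat} (qs qs' : n.-tuple Q) (j : 'I_n)
    (hj : forall i, i != j -> tnth qs i = tnth qs' i)
    (alpha beta s : R) (x0 : 'rV[R]_d) (idx : nat -> 'I_n)
    (W := fun k => enorm (SUM_erm l qs alpha beta s x0 idx k
                          - SUM_erm l qs' alpha beta s x0 idx k)) (t : nat) :
  0 <= alpha -> 0 <= beta < 1 -> 0 <= s ->
  W t.+1 <= \sum_(k < t.+1) alpha * SUM_eta beta s k t *
    (2 * G * (idx k == j)%:R + L * (W k - (idx k == j)%:R * W k)).
Proof.
move=> alpha0 beta01 s0.
apply: le_trans (SUM_iterate_dist_le _ _ _ _ _ _ _ alpha0 beta01 s0) _.
apply: ler_sum => k _; apply: ler_wpM2l.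
  by rewrite mulr_ge0// SUM_eta_ge0.
have [->|ij] := eqVneq (idx k) j.
  rewrite mulr1 mul1r subrr mulr0 addr0 mulr2n mulrDl mul1r.
  exact: le_trans (enormB _ _) (lerD (hG _ _) (hG _ _)).
by rewrite mulr0 mul0r subr0 add0r (hj _ ij); exact: (hL _).2.
Qed.

Theorem proposition3 (R : realType) (d : nat) (Q : Type)
  (l : 'rV[R]_d -> Q -> R) (G L : R)
  (hG : forall x q, enorm (gradient (fun y => l y q) x) <= G)
  (hL : forall q, smooth L (fun y => l y q))
  (n : nat) (qs qs' : n.-tuple Q) (hS : differ_at_one qs qs')
  (alpha beta s : R) (halpha : 0 < alpha) (hbeta : 0 <= beta < 1)
  (hs : 0 <= s) (x0 : 'rV[R]_d)
  (disp : measure_display) (T : measurableType disp) (P : probability T R)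
  (I : nat -> T -> 'I_n) (hI : random_indices I)
  (hunif : uniform_indices P I) (hindep : independent_indices P I) :
  let D := Delta P l qs qs' alpha beta s x0 I in
  D 0%N = 0%E /\
  forall t : nat,
    (D t.+1 <=
       (\sum_(k < t.+1) 2 * alpha * G / n%:R * SUM_eta beta s k t)%R%:E
       + (1 - n%:R^-1)%R%:E
         * \sum_(k < t.+1) (alpha * L * SUM_eta beta s k t)%R%:E * D k)%E.
Proof.
move=> D.
pose W k idx := enorm (SUM_erm l qs alpha beta s x0 idx k
                       - SUM_erm l qs' alpha beta s x0 idx k).
have Wext k idx idx' : (forall m, (m < k)%N -> idx m = idx' m) ->
    W k idx = W k idx'.
  by move=> ext; rewrite /W !(SUM_erm_ext _ _ _ _ _ _ _ _ _ ext).
split=> [|t].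
  rewrite /D /Delta (_ : (fun _ => _) = cst 0) ?expectation_cst//.
  by apply/funext => w; rewrite subrr enorm0.
case: hS => j hj.
have n0 : n%:R != 0 :> R by rewrite pnatr_eq0 -lt0n (leq_ltn_trans _ (ltn_ord j)).
pose seq_of (w : {ffun 'I_t.+1 -> 'I_n}) k := w (inord k).
pose mu := n%:R^-1 ^+ t.+1 : R.
pose e k := mu * \sum_w W k (seq_of w).
have DE k : (k <= t.+1)%N -> D k = (e k)%:E.
  move=> kt; apply: (expectation_indices P I t (W k) hI hunif hindep).
    by move=> idx; exact: enorm_ge0.
  by move=> idx idx' ext; apply: Wext => m mk; apply: ext; exact: leq_trans kt.
have mu1 : mu * \sum_(w : {ffun 'I_t.+1 -> 'I_n}) 1 = 1.
  rewrite sumr_const card_ffun !card_ord natrX /mu exprVn mulVf//.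
  exact: expf_neq0.
have seq_of_ord w (k : 'I_t.+1) : seq_of w k = w k by rewrite /seq_of inord_val.
have hit (k : 'I_t.+1) : mu * \sum_w (seq_of w k == j)%:R = n%:R^-1.
  under eq_bigr do rewrite seq_of_ord -[_%:R]mulr1.
  by rewrite (sum_ffun_coord k j (fun=> 1))// mulrCA mu1 mulr1.
have hitW (k : 'I_t.+1) :
    mu * \sum_w (seq_of w k == j)%:R * W k (seq_of w) = n%:R^-1 * e k.
  under eq_bigr do rewrite seq_of_ord.
  rewrite (sum_ffun_coord k j (fun w => W k (seq_of w)) n0); first by rewrite mulrCA.
  (* [W k] reads only indices m < k, so a change at coordinate k does not affect it. *)
  move=> w w' ww'; apply: Wext => m mk; apply: ww'; apply/eqP => mE.
  have mt := ltn_trans mk (ltn_ord k).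
  by move: mk; rewrite -mE inordK// ltnn.
(* All expectations are finite, so the inequality moves to the reals. *)
rewrite DE// (eq_bigr (fun k : 'I_t.+1 =>
  (alpha * L * SUM_eta beta s k t * e k)%:E)); last first.
  by move=> k _; rewrite DE ?(ltnW (ltn_ord k)).
rewrite sumEFin -EFinM -EFinD lee_fin.
apply: (@le_trans _ _ (mu * \sum_(w : {ffun 'I_t.+1 -> 'I_n}) \sum_(k < t.+1)
    alpha * SUM_eta beta s k t * (2 * G * (seq_of w k == j)%:R +
      L * (W k (seq_of w) - (seq_of w k == j)%:R * W k (seq_of w))))).
  apply: ler_wpM2l; first by rewrite exprn_ge0// invr_ge0 ler0n.
  by apply: ler_sum => w _; apply: SUM_erm_dist_le => //; exact: ltW.
rewrite exchange_big mulr_sumr mulr_sumr -big_split /=.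
apply: ler_sum => k _.
rewrite -mulr_sumr big_split /= -!mulr_sumr sumrB.
move: (hit k) (hitW k); rewrite -/(e k).
set A := \sum_w _%:R; set B := \sum_w _ * _; rewrite /e; set C := \sum_w _.
move=> hA hB.
(* Averaging gives 1/n for A and Delta_k / n for B; then L (Delta_k - Delta_k / n) yields the factor
   1 - 1/n, with equality in each term. *)
have -> : mu * (alpha * SUM_eta beta s k t * (2 * G * A + L * (C - B))) =
  alpha * SUM_eta beta s k t * (2 * G * (mu * A) + L * (mu * C - mu * B)) by ring.
by rewrite hA hB le_eqVlt; apply/orP; left; apply/eqP; ring.
Qed.
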